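(* Let $\mathscr C_\omega$ and $\mathscr C_2$ be the Fraïssé limits of the class of finite $C$-relations and of the class of finite binary $C$-relations respectively. Let $\mathrm{C_4}$ be the $C$-relation on the 4-element set $\{\mathrm a, \mathrm b, \mathrm c, \mathrm d\}$ uniquely determined by declaring $C(\mathrm a; \mathrm c, \mathrm d)$, $C(\mathrm b; \mathrm c, \mathrm d)$, and $C(\mathrm c; \mathrm a, \mathrm b)$. Then $\mathrm d(\mathscr C_2 : \mathrm{C_4}) = \mathrm d(\mathscr C_\omega : \mathrm{C_4}) = \infty$.
   Context: A pseudotree is a structure $T$ with a (reflexive, antisymmetric, transitive) order relation $\leq$ and a binary function $\wedge$ such that $\sup\{x \in T : x \leq a,\ x \leq b\} = a \wedge b$ for all $a,b \in T$ (in particular this supremum exists), and such that for each $a \in T$ the set $\{x \in T : x \leq a\}$ is linearly ordered by $\leq$. A pseudotree $T$ is binary if for every $a \in T$ and $x,y,z > a$ it is not the case that $a = x\wedge y = x \wedge z = y \wedge z$. A finite set $L$ equipped with a ternary relation $C$ is a (finite) $C$-relation structure, or just a $C$-relation, if there is a finite pseudotree $T$ such that the set $L$ consists of maximal elements of $T$, and $C(a;b,c)$ holds exactly when $a \wedge b < b \wedge c$ (for $a,b,c\in L$). It is a binary $C$-relation if $T$ can be taken to be a binary pseudotree. The class of finite $C$-relations and the class of finite binary $C$-relations are both Fraïssé classes (in the language with one ternary relation symbol). For structures $A, B$, $\binom{B}{A}$ is the set of all substructures of $B$ isomorphic to $A$. A natural number $\ell$ is identified with $\{0,\dots,\ell-1\}$.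 For $\ell \in \omega$ write $B \to (B)^A_\ell$ if for every function $c\colon \binom{B}{A} \to \ell$ there exists $D \in \binom{B}{B}$ such that the image $c\left[\binom{D}{A}\right]$ is not equal to $\ell$ (i.e. some color is omitted). The big Ramsey degree $\mathrm d(B : A)$ of $A$ in $B$ is the smallest $\ell\in\omega$ for which $B \to (B)^A_{\ell+1}$, and $\mathrm d(B:A) = \infty$ if no such $\ell$ exists. *)

(* Defs.v *)
From HB Require Import structures.
From mathcomp Require Import all_boot all_order.
From mathcomp Require Import boolp classical_sets functions cardinality.

Set Implicit Arguments.
Unset Strict Implicit.
Unset Printing Implicit Defensive.

Import Order.TTheory.
Local Open Scope classical_set_scope.
Local Open Scope order_scope.

Section Pseudotree.
Variables (d : Order.disp_t) (T : porderType d) (meet : T -> T -> T).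

Definition pseudotree : Prop :=
  (forall a b, supremums [set x : T | x <= a /\ x <= b] (meet a b)) /\
  (forall a, total_on [set x : T | x <= a] (fun x y => x <= y)).

Definition binary_pseudotree : Prop :=
  pseudotree /\
  (forall a x y z : T, a < x -> a < y -> a < z ->
    ~ [/\ a = meet x y, a = meet x z & a = meet y z]).

End Pseudotree.

(* [tern x y z] is C(x; y, z). *)
Record ternary := Ternary {
  carrier :> Type;
  tern : carrier -> carrier -> carrier -> Prop }.

(* [X] is, up to renaming its points along the injection [f], a set of maximal
   elements of [T] with the ternary relation read off from [meet]. *)
Definition leaf_structure d (T : porderType d) (meet : T -> T -> T)
    (X : ternary) : Prop :=
  exists f : X -> T,
    [/\ injective f,
        forall (x : X) (t : T), f x <= t -> t = f x &
        forall x y z : X,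
          tern x y z <-> meet (f x) (f y) < meet (f y) (f z)].

Definition C_relation (X : ternary) : Prop :=
  finite_set [set: X] /\
  exists (d : Order.disp_t) (T : finPOrderType d) (meet : T -> T -> T),
    pseudotree meet /\ leaf_structure meet X.

Definition binary_C_relation (X : ternary) : Prop :=
  finite_set [set: X] /\
  exists (d : Order.disp_t) (T : finPOrderType d) (meet : T -> T -> T),
    binary_pseudotree meet /\ leaf_structure meet X.

Definition isomorphism (X Y : ternary) (f : X -> Y) : Prop :=
  bijective f /\
  forall x y z : X, tern x y z <-> tern (f x) (f y) (f z).

Definition isomorphic (X Y : ternary) : Prop :=
  exists f : X -> Y, isomorphism f.

Definition induced (X : ternary) (S : set X) : ternary :=
  @Ternary S (fun x y z => tern (val x) (val y) (val z)).

(* The set of substructures of [B] isomorphic to [A], a substructure being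
   identified with its underlying set. *)
Definition copies (B A : ternary) : set (set B) :=
  [set S | isomorphic (induced S) A].
Arguments copies : clear implicits.

Definition Fraisse_limit (K : ternary -> Prop) (M : ternary) : Prop :=
  [/\ countable [set: M],
      forall S : set M, finite_set S -> K (induced S),
      forall X : ternary, K X -> exists S : set M, copies M X S &
      forall (S S' : set M) (f : induced S -> induced S'),
        finite_set S -> isomorphism f ->
        exists2 g : M -> M, isomorphism g &
          forall x : induced S, g (val x) = val (f x)].

(* A substructure of [D] is a substructure of [B] contained in [D], so the
   image below is c[copies D A]. *)
Definition arrow (B A : ternary) (l : nat) : Prop :=
  forall c : copies B A -> 'I_l,
    exists2 D : set B, copies B B D &
      c @` [set S | val S `<=` D] <> [set: 'I_l].

(* [None] stands for infinity. *)
Definition big_ramsey_degree (B A : ternary) : option nat :=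
  match pselect (exists l : nat, `[< arrow B A l.+1 >]) with
  | left h => Some (ex_minn h)
  | right _ => None
  end.

Variant C4_point : Set := C4a | C4b | C4c | C4d.

Definition is_C4 (R : C4_point -> C4_point -> C4_point -> Prop) : Prop :=
  [/\ C_relation (Ternary R), R C4a C4c C4d, R C4b C4c C4d & R C4c C4a C4b].

(* The tree ((a b)(c d)), with root [None], inner nodes [Some (s, None)] and
   leaves [Some (s, Some t)]. *)
Definition C4_tree : Type := option (bool * option bool).
HB.instance Definition _ := Finite.on C4_tree.

Definition C4_tree_le (x y : C4_tree) : bool :=
  match x, y with
  | None, _ => true
  | Some (s, None), Some (s', _) => s == s'
  | Some (s, Some t), Some (s', Some t') => (s == s') && (t == t')
  | _, _ => false
  end.

Definition C4_tree_meet (x y : C4_tree) : C4_tree :=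
  match x, y with
  | Some (s, t), Some (s', t') =>
      if s == s' then Some (s, if t == t' then t else None) else None
  | _, _ => None
  end.

Lemma C4_tree_le_refl : reflexive C4_tree_le.
Proof. by do ![case=> //]. Qed.

Lemma C4_tree_le_anti : antisymmetric C4_tree_le.
Proof. by move=> [[[] [[]|]]|] [[[] [[]|]]|]. Qed.

Lemma C4_tree_le_trans : transitive C4_tree_le.
Proof. by move=> [[[] [[]|]]|] [[[] [[]|]]|] [[[] [[]|]]|]. Qed.

Fact C4_tree_display : Order.disp_t. Proof. exact: Order.Disp tt tt. Qed.

HB.instance Definition _ := Order.Le_isPOrder.Build C4_tree_display C4_tree
  C4_tree_le_refl C4_tree_le_anti C4_tree_le_trans.

Lemma C4_tree_leE (x y : C4_tree) : (x <= y) = C4_tree_le x y.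
Proof. by []. Qed.

Lemma C4_tree_pseudotree : pseudotree C4_tree_meet.
Proof.
split=> [x y|z x y].
  split=> [z [] | z /(_ (C4_tree_meet x y))]; rewrite !C4_tree_leE.
    by move: x y z => [[[] [[]|]]|] [[[] [[]|]]|] [[[] [[]|]]|].
  by apply; split; rewrite !C4_tree_leE;
    move: x y {z} => [[[] [[]|]]|] [[[] [[]|]]|].
rewrite /= !C4_tree_leE => xz yz; apply/orP; move: xz yz.
by move: x y z => [[[] [[]|]]|] [[[] [[]|]]|] [[[] [[]|]]|].
Qed.

Definition C4_leaf (p : C4_point) : C4_tree :=
  match p with
  | C4a => Some (false, Some false)
  | C4b => Some (false, Some true)
  | C4c => Some (true, Some false)
  | C4d => Some (true, Some true)
  end.

Lemma C4_exists_unique : exists! R, is_C4 R.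
Proof.
pose m x y := C4_tree_meet (C4_leaf x) (C4_leaf y).
pose R0 x y z := is_true (m x y < m y z).
exists R0; split.
  have inj : injective C4_leaf by case=> -[].
  split=> //; split.
    have -> : [set: Ternary R0] = C4_leaf @^-1` setT by [].
    by apply: finite_preimage => [x y _ _ /inj//|]; exact: finite_finset.
  exists C4_tree_display, C4_tree, C4_tree_meet.
  split; first exact: C4_tree_pseudotree.
  exists C4_leaf; split=> // x t.
  by rewrite C4_tree_leE; move: x t => [] [[[] [[]|]]|].
move=> R [[_ [d [T [meet [[sup lin] [f [inj mx Rf]]]]]]] Racd Rbcd Rcab].
have le_l x y : meet x y <= x by case: (sup x y) => _; apply=> z [].
have le_r x y : meet x y <= y by case: (sup x y) => _; apply=> z [].
have le_m z x y : z <= x -> z <= y -> z <= meet x y.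
  by move=> zx zy; case: (sup x y) => + _; apply.
have mC x y : meet x y = meet y x by apply/le_anti; rewrite !le_m.
have iso x y z : meet x y < meet y z -> meet x z = meet x y.
  move=> lt; apply/le_anti/andP; split; apply: (le_m) => //; last first.
    by rewrite (le_trans _ (le_r y z)) // ltW.
  case: (lin z (meet x z) (meet y z)) => //= le; first exact: le_trans (le_l y z).
  have := lt_geF lt; rewrite le_m //; exact: le_trans le (le_l x z).
have leaf x y : x <> y -> meet (f x) (f y) < f x.
  move=> ne; rewrite lt_neqAle le_l andbT; apply/eqP => e; apply: ne.
  by apply/esym/inj/mx; rewrite -e.
have mxx x : meet x x = x by apply/le_anti; rewrite le_l le_m.
move: Racd Rbcd Rcab => /Rf ru /Rf r'u /Rf rv.
have Ead := iso _ _ _ ru; have Ebd := iso _ _ _ r'u; have Ecb := iso _ _ _ rv.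
have Ebc : meet (f C4b) (f C4c) = meet (f C4a) (f C4c).
  by rewrite mC Ecb mC.
rewrite {r'u}Ebc in Ebd Ecb *; rewrite mC in rv.
have va : meet (f C4a) (f C4b) < f C4a by exact: leaf.
have vb : meet (f C4a) (f C4b) < f C4b by rewrite mC; exact: leaf.
have uc : meet (f C4c) (f C4d) < f C4c by exact: leaf.
have ud : meet (f C4c) (f C4d) < f C4d by rewrite mC; exact: leaf.
have ra := lt_trans rv va; have rb := lt_trans rv vb.
have rc := lt_trans ru uc; have rd := lt_trans ru ud.
have Eca := mC (f C4c) (f C4a); have Eba := mC (f C4b) (f C4a).
have Edc := mC (f C4d) (f C4c).
have Eda := etrans (mC (f C4d) (f C4a)) Ead.
have Edb := etrans (mC (f C4d) (f C4b)) Ebd.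
have Ebc := etrans (mC (f C4b) (f C4c)) Ecb.
rewrite {}Eca in Ecb Ebc.
apply/funext => x; apply/funext => y; apply/funext => z.
have -> : R x y z = (meet (f x) (f y) < meet (f y) (f z)) :> Prop.
  by apply/propext; exact: Rf.
rewrite /R0; congr is_true.
have E := (mxx, Ead, Ebd, Ecb, Ebc, Eda, Edb, Eba, Edc, mC (f C4c) (f C4a)).
have L := (ltxx, rv, ru, va, vb, uc, ud, ra, rb, rc, rd).
have G := (lt_gtF rv, lt_gtF ru, lt_gtF va, lt_gtF vb, lt_gtF uc, lt_gtF ud,
  (lt_gtF ra, lt_gtF rb, lt_gtF rc, lt_gtF rd)).
by case: x; case: y; case: z; rewrite ?E ?L ?G.
Qed.

(* Main.v *)
(* Enumerate the leaves. A copy of C_4 splits at its root r into two branches,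
   up to the nodes x = a /\ b and y = c /\ d. On the branch to x, call a leaf v
   above r a record if v /\ x lies above u /\ x for every earlier leaf u, and
   colour the copy by the maximal number of alternations between records of the
   two branches, modulo the number of colours. In a subcopy D, records towards
   nodes below a fixed leaf a have index at most that of a, so they stabilise as
   the node x in D moves up to a. Branching off from a at a node of D so close
   to a, into a cone without leaves of small index, then keeps all records and
   adds a nonempty block of later ones, which raises the number of alternations
   by exactly one. Hence D meets all large numbers of alternations. *)

From mathcomp Require Import all_boot all_order.
From mathcomp Require Import boolp classical_sets functions cardinality.
Require Import Defs.

Set Implicit Arguments.
Unset Strict Implicit.
Unset Printing Implicit Defensive.

Import Order.TTheory.
Local Open Scope classical_set_scope.

(** * Axioms of C-relations *)

(** The usual universal axioms of C-relations. Each involves at most four points, so they pass from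
    the finite substructures to an infinite structure. *)
Definition C_axioms (X : ternary) : Prop :=
  [/\ forall x y z : X, tern x y z -> tern x z y,
      forall x y z : X, tern x y z -> ~ tern y x z,
      forall x y z w : X, tern x y z -> tern x w z \/ tern w y z &
      forall x y : X, x <> y -> tern x y y].

(** The nodes below a common leaf form a chain, so meets with that leaf can be compared; the last
    axiom comes from the maximality of leaves. *)
Lemma leaf_structure_C_axioms d (T : porderType d) (meet : T -> T -> T)
    (X : ternary) :
  pseudotree meet -> leaf_structure meet X -> C_axioms X.
Proof.
move=> [sup lin] [f [inj mx Rf]].
have le_l x y : (meet x y <= x)%O by case: (sup x y) => _; apply=> z [].
have le_r x y : (meet x y <= y)%O by case: (sup x y) => _; apply=> z [].
have le_m z x y : (z <= x)%O -> (z <= y)%O -> (z <= meet x y)%O.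
  by move=> zx zy; case: (sup x y) => + _; apply.
have mC x y : meet x y = meet y x by apply/le_anti; rewrite !le_m.
have ltN (p q z : T) : (p <= z)%O -> (q <= z)%O -> ~ (p < q)%O -> (q <= p)%O.
  move=> pz qz npq; case: (lin z p q pz qz) => //.
  by rewrite le_eqVlt => /orP[/eqP->//|/npq].
have iso x y z : (meet x y < meet y z)%O -> meet x z = meet x y.
  move=> lt; apply/le_anti/andP; split; apply: (le_m) => //; last first.
    by rewrite (le_trans _ (le_r y z)) // ltW.
  case: (lin z (meet x z) (meet y z)) => //= le; first exact: le_trans (le_l y z).
  have := lt_geF lt; rewrite le_m //; exact: le_trans le (le_l x z).
split=> [x y z /Rf lt|x y z /Rf lt /Rf|x y z w /Rf lt|x y ne].
- by apply/Rf; rewrite (iso _ _ _ lt) (mC (f z)).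
- by rewrite (iso _ _ _ lt) mC ltxx.
- case: (pselect (tern w y z)) => [|/Rf nwyz]; first by right.
  have yzw := ltN _ _ _ (le_r _ _) (le_l _ _) nwyz.
  left; apply/Rf; apply: contrapT => nxwz.
  have wzx := ltN _ _ _ (le_r _ _) (le_l _ _) nxwz.
  have := lt_geF lt; rewrite le_m //.
  apply: le_trans (le_l _ (f w)); apply: le_trans wzx.
  by rewrite le_m // (le_trans yzw).
- have mxx u : meet u u = u by apply/le_anti; rewrite le_l le_m.
  apply/Rf; rewrite mxx lt_neqAle le_r andbT; apply/eqP => e; apply: ne.
  by apply/inj/mx; rewrite -e.
Qed.

Lemma C_axioms_of_finite (X : ternary) :
  (forall S : set X, finite_set S -> C_relation (induced S)) -> C_axioms X.
Proof.
move=> HX.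
pose S (x y z w : X) : set X := [set x] `|` [set y] `|` [set z] `|` [set w].
have SA x y z w : C_axioms (induced (S x y z w)).
  have [|_ [d [T [meet [pt ls]]]]] := HX (S x y z w).
    by rewrite /S !finite_setU; do !split; exact: finite_set1.
  exact: leaf_structure_C_axioms pt ls.
have m1 x y z w : x \in S x y z w by rewrite inE; left; left; left.
have m2 x y z w : y \in S x y z w by rewrite inE; left; left; right.
have m3 x y z w : z \in S x y z w by rewrite inE; left; right.
have m4 x y z w : w \in S x y z w by rewrite inE; right.
split=> [x y z|x y z|x y z w|x y].
- have [A _ _ _] := SA x y z z.
  exact: (A (SigSub (m1 x y z z)) (SigSub (m2 x y z z)) (SigSub (m3 x y z z))).
- have [_ A _ _] := SA x y z z.
  exact: (A (SigSub (m1 x y z z)) (SigSub (m2 x y z z)) (SigSub (m3 x y z z))).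
- have [_ _ A _] := SA x y z w.
  exact: (A (SigSub (m1 x y z w)) (SigSub (m2 x y z w)) (SigSub (m3 x y z w))
            (SigSub (m4 x y z w))).
- have [_ _ _ A] := SA x y y y => ne.
  apply: (A (SigSub (m1 x y y y)) (SigSub (m2 x y y y))).
  by move=> /(congr1 val).
Qed.

(** * Alternations between two sets of indexed points *)

Section Alternation.
Variables (T : Type) (idx : T -> nat).
Implicit Types P Q : T -> Prop.

(** Here [k] counts changes of side, so the sequence behind it has [k.+1] points. *)
Fixpoint alternating P Q (k : nat) (v : T) : Prop :=
  if k is k'.+1 then
    exists2 u, alternating P Q k' u &
      (idx u < idx v)%N /\ (P u /\ Q v \/ Q u /\ P v)
  else P v \/ Q v.

Definition alternation P Q k : Prop :=
  (exists v, alternating P Q k v) /\ ~ (exists v, alternating P Q k.+1 v).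

Lemma alternating_mem P Q k v : alternating P Q k v -> P v \/ Q v.
Proof. by case: k => // k [u _ [_ [[]|[]]]]; [right|left]. Qed.

Lemma alternating_le_idx P Q k v : alternating P Q k v -> (k <= idx v)%N.
Proof.
elim: k v => // k IH v [u /IH ku [uv _]]; exact: leq_ltn_trans ku uv.
Qed.

(** Indices increase along the sequence, so if its last point lies before [N], all of it does, and
    the inclusions matter only there. *)
Lemma alternatingW P Q P' Q' N k v :
  (forall v, (idx v < N)%N -> P v -> P' v) ->
  (forall v, (idx v < N)%N -> Q v -> Q' v) ->
  (idx v < N)%N -> alternating P Q k v -> alternating P' Q' k v.
Proof.
move=> PP QQ; elim: k v => [|k IH] v vN /=.
  by case=> [/(PP _ vN)|/(QQ _ vN)]; [left|right].
move=> [u alt [uv PQ]]; have uN := ltn_trans uv vN.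
exists u; first exact: IH.
split=> //; case: PQ => -[Hu Hv]; [left|right];
  by split; [exact: PP Hu || exact: QQ Hu|exact: PP Hv || exact: QQ Hv].
Qed.

Lemma alternatingC P Q k v : alternating P Q k v -> alternating Q P k v.
Proof.
elim: k v => [|k IH] v /=; first by case; [right|left].
by move=> [u /IH alt [uv PQ]]; exists u => //; split=> //; case: PQ; [right|left].
Qed.

Lemma alternating_leq P Q k l : (k <= l)%N ->
  (exists v, alternating P Q l v) -> exists v, alternating P Q k v.
Proof.
move=> /subnK <-; elim: (l - k)%N => // n IH [v [u alt _]].
by apply: IH; exists u.
Qed.

Lemma alternation_uniq P Q k l : alternation P Q k -> alternation P Q l -> k = l.
Proof.
move=> [exk nk] [exl nl]; case: (ltngtP k l) => // lt; exfalso.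
  exact: nk (alternating_leq lt exl).
exact: nl (alternating_leq lt exk).
Qed.

Lemma eq_alternation P Q P' Q' k :
  (forall v, P v <-> P' v) -> (forall v, Q v <-> Q' v) ->
  alternation P Q k -> alternation P' Q' k.
Proof.
move=> PP QQ; have -> : P = P' by apply/funext => v; exact/propext/PP.
by have -> : Q = Q' by apply/funext => v; exact/propext/QQ.
Qed.

Lemma alternationC P Q k : alternation P Q k -> alternation Q P k.
Proof.
move=> [[v alt] n]; split; first by exists v; exact: alternatingC.
by move=> [u /alternatingC altu]; apply: n; exists u.
Qed.

Lemma alternation_exists P Q N : (exists v, P v) ->
  (forall v, P v \/ Q v -> (idx v <= N)%N) -> exists k, alternation P Q k.
Proof.
move=> [v Pv] bd.
have ex : exists k, `[< exists v, alternating P Q k v >].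
  by exists 0%N; apply/asboolP; exists v; left.
have ub k : `[< exists v, alternating P Q k v >] -> (k <= N)%N.
  move=> /asboolP[u alt]; apply: leq_trans (bd u _).
    exact: alternating_le_idx alt.
  exact: alternating_mem alt.
case: (ex_maxnP ex ub) => k /asboolP exk max; exists k; split=> // exk1.
by have := max k.+1; rewrite ltnn => /(_ (asboolT exk1)).
Qed.

(* A nonempty block of P-points beyond N adds one alternation when the longest
   alternating sequence can end in Q: two points of the block are not
   alternating, so a sequence uses at most one of them. *)
Lemma alternation_extend P P' Q N k :
  (forall v, (idx v < N)%N -> P v <-> P' v) ->
  (forall v, Q v -> (idx v < N)%N) ->
  (exists2 v, P' v & (N <= idx v)%N) ->
  alternation P Q k -> (exists2 v, Q v & alternating P Q k v) ->
  alternation P' Q k.+1 /\ exists2 v, P' v & alternating P' Q k.+1 v.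
Proof.
move=> PP QN [w P'w Nw] [_ nk] [v Qv alt]; have vN := QN v Qv.
have alt' : alternating P' Q k.+1 w.
  exists v; first by apply: (alternatingW (N := N)) alt => // u uN; case: (PP u uN).
  by split; [exact: leq_trans Nw|right].
split; last by exists w.
split; first by exists w.
move=> [u [u' alt2 [lt PQ]]].
have u'N : (idx u' < N)%N.
  case: PQ => -[Hu' Hu]; last exact: QN.
  by apply: ltn_trans (QN u Hu).
apply: nk; exists u'; apply: (alternatingW (N := N) (k := k.+1)) alt2 => //.
by move=> z zN; case: (PP z zN).
Qed.

End Alternation.

(** * Calculus of C-relations *)

Section CRelation.
Variables (X : ternary) (ax : C_axioms X).
Implicit Types a b c d u v w : X.

Lemma C_sym u v w : tern u v w -> tern u w v.
Proof. by case: ax => + _ _ _; apply. Qed.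

Lemma C_asym u v w : tern u v w -> ~ tern v u w.
Proof. by case: ax => _ + _ _; apply. Qed.

(** In a tree [tern u v a] says u /\ a < v /\ a: for fixed [a] it is a strict weak order by the
    height of branching off from [a]. This is its negative transitivity, [C_trans] its
    transitivity. *)
Lemma C_split u v a w : tern u v a -> tern u w a \/ tern w v a.
Proof. by case: ax => _ _ + _; apply. Qed.

Lemma C_neq u v : u <> v -> tern u v v.
Proof. by case: ax => _ _ _; apply. Qed.

Lemma C_irrefl u v : ~ tern u u v.
Proof. by move=> h; exact: C_asym (h) (h). Qed.

Lemma C_irreflr u v : ~ tern u v u.
Proof. by move=> /C_sym; exact: C_irrefl. Qed.

Lemma C_trans v u w a : tern u v a -> tern v w a -> tern u w a.
Proof. by move=> uv /(C_split u) [/(C_asym uv)|]. Qed.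

Lemma C_path u v a a' : tern u a a' -> tern u v a -> tern u v a'.
Proof.
move=> uaa' /C_sym /(C_split a') [/C_sym //|a'av].
by case: (C_split v uaa') => // vaa'; case: (C_asym (C_sym vaa') (C_sym a'av)).
Qed.

(** The leaves [a] and [a'] branch off from [c] at the same node. *)
Lemma C_base a a' c d : tern c a a' -> tern a c d -> tern a' c d.
Proof.
move=> caa' acd; case: (C_split a' acd) => // aa'd; exfalso.
have cda' : tern c d a' := C_trans caa' (C_sym aa'd).
exact: (C_asym acd) (C_sym (C_path (C_sym caa') cda')).
Qed.

(** * Labelled copies of C_4 *)

(** The inequalities exclude degenerate cases, since [tern c a a] holds for distinct [c] and [a].
    The remaining relation [tern b c d] follows by [C_base]. *)
Definition C4_labelled a b c d : Prop :=
  [/\ a <> b, c <> d, tern c a b & tern a c d].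

Lemma C4_labelled_swap a b c d : C4_labelled a b c d -> C4_labelled c d a b.
Proof. by case. Qed.

Lemma C4_labelled_swapl a b c d : C4_labelled a b c d -> C4_labelled b a c d.
Proof.
by move=> [ab cd cab acd]; split=> //; [exact/nesym|exact: C_sym|exact: C_base cab acd].
Qed.

Lemma C4_labelled_swapr a b c d : C4_labelled a b c d -> C4_labelled a b d c.
Proof. by move=> /C4_labelled_swap/C4_labelled_swapl/C4_labelled_swap. Qed.

(** Swapping the leaves of one branch and exchanging the branches generate the automorphism group of
    C_4, hence reach every labelling of the same four points. *)
Lemma C4_labelled_transport (P : X -> X -> X -> X -> Prop) a b c d p q r s :
  (forall a b c d, C4_labelled a b c d -> P a b c d -> P b a c d) ->
  (forall a b c d, C4_labelled a b c d -> P a b c d -> P c d a b) ->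
  C4_labelled a b c d -> C4_labelled p q r s ->
  [set p; q; r; s] `<=` [set a; b; c; d] -> P a b c d -> P p q r s.
Proof.
move=> Pl Psw lab lab' sub Pabcd.
have mem x : [set a; b; c; d] x -> [\/ x = a, x = b, x = c | x = d].
  case=> [[[]|]|] ->.
  - by constructor 1.
  - by constructor 2.
  - by constructor 3.
  - by constructor 4.
have /mem pm : [set a; b; c; d] p by apply: sub; left; left; left.
have /mem qm : [set a; b; c; d] q by apply: sub; left; left; right.
have /mem rm : [set a; b; c; d] r by apply: sub; left; right.
have /mem sm : [set a; b; c; d] s by apply: sub; right.
have main a' b' c' d' : C4_labelled a' b' c' d' -> p = a' ->
    [\/ q = a', q = b', q = c' | q = d'] -> [\/ r = a', r = b', r = c' | r = d'] ->
    [\/ s = a', s = b', s = c' | s = d'] -> P a' b' c' d' -> P p q r s.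
  move=> labl E; move: labl lab'; rewrite {}E => labl labl'.
  have [_ _ ca'b' a'c'd'] := labl; have [pq rs rpq prs] := labl'.
  have [_ _ spq _] := C4_labelled_swapr labl'.
  have [_ _ d'a'b' _] := C4_labelled_swapr labl.
  have ir u v : ~ tern u u v by exact: C_irrefl.
  have irr u v : ~ tern u v u by exact: C_irreflr.
  have nba'c' : ~ tern b' a' c' by move=> /C_sym; exact: C_asym (C_sym ca'b').
  have nba'd' : ~ tern b' a' d' by move=> /C_sym; exact: C_asym (C_sym d'a'b').
  have nca'd' : ~ tern c' a' d' := C_asym a'c'd'.
  have nda'c' : ~ tern d' a' c' := C_asym (C_sym a'c'd').
  move=> qm' rm' sm' P'.
  (* For [q] on the other branch, no point of the set could serve as [r] with [tern r a' q]. *)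
  have qb : q = b'.
    case: qm' => qE //; first by case: pq.
      by exfalso; move: rm' rpq; rewrite qE => -[] -> //; [exact: ir|exact: irr].
    by exfalso; move: rm' rpq; rewrite qE => -[] -> //; [exact: ir|exact: irr].
  move: rpq spq; rewrite {}qb => rpq spq.
  have rcd : r = c' \/ r = d'.
    case: rm' => rE; [by case: (ir a' b'); rewrite -{1}rE|
      by case: (irr b' a'); rewrite -{1}rE|by left|by right].
  have scd : s = c' \/ s = d'.
    case: sm' => sE; [by case: (ir a' b'); rewrite -{1}sE|
      by case: (irr b' a'); rewrite -{1}sE|by left|by right].
  (* Conjugating the swap in the first branch by the exchange of branches swaps [c'] and [d']. *)
  have Psw' := Psw _ _ _ _ labl P'.
  have Pr := Pl _ _ _ _ (C4_labelled_swap labl) Psw'.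
  have {}Pr := Psw _ _ _ _ (C4_labelled_swapl (C4_labelled_swap labl)) Pr.
  by case: rcd scd rs => -> [] ->.
have labs := C4_labelled_swap lab; have Ps := Psw _ _ _ _ lab Pabcd.
have labl := C4_labelled_swapl lab; have Plab := Pl _ _ _ _ lab Pabcd.
have labsl := C4_labelled_swapl labs; have Psl := Pl _ _ _ _ labs Ps.
have permba x : [\/ x = a, x = b, x = c | x = d] -> [\/ x = b, x = a, x = c | x = d].
  by case; [constructor 2|constructor 1|constructor 3|constructor 4].
have permcd x : [\/ x = a, x = b, x = c | x = d] -> [\/ x = c, x = d, x = a | x = b].
  by case; [constructor 3|constructor 4|constructor 1|constructor 2].
have permdc x : [\/ x = a, x = b, x = c | x = d] -> [\/ x = d, x = c, x = a | x = b].
  by case; [constructor 3|constructor 4|constructor 2|constructor 1].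
case: pm => pE.
- exact: main lab pE qm rm sm Pabcd.
- exact: main labl pE (permba _ qm) (permba _ rm) (permba _ sm) Plab.
- exact: main labs pE (permcd _ qm) (permcd _ rm) (permcd _ sm) Ps.
- exact: main labsl pE (permdc _ qm) (permdc _ rm) (permdc _ sm) Psl.
Qed.

(** * Records along an enumeration *)

Section Enumeration.
Variables (idx : X -> nat) (idx_inj : injective idx).

(* With r = a /\ c < x = a /\ b: v /\ x lies above r, and above u /\ x for all u
   preceding v. *)
Definition record a b c v : Prop :=
  tern c v a /\ forall u, (idx u < idx v)%N -> tern u v a /\ tern u a b.

(** The leaf [a] cannot precede a record, as nothing meets [a] strictly above [a] itself. *)
Lemma record_idx a b c v : record a b c v -> (idx v <= idx a)%N.
Proof.
by move=> [_ h]; rewrite leqNgt; apply/negP => /h [/C_irreflr].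
Qed.

(** The first leaf in the cone of [a] above the root works: all earlier leaves branch off from [a]
    at the root or below. *)
Lemma record_exists a b c : tern c a b -> exists v, record a b c v.
Proof.
move=> cab.
have ex : exists n, `[< exists2 v, idx v = n & tern c v a >].
  exists (idx a); apply/asboolP; exists a => //; apply: C_neq => e.
  by move: cab; rewrite e => /C_irrefl.
case: (ex_minnP ex) => n /asboolP [v <- cva] min.
exists v; split=> // u uv.
have ncua : ~ tern c u a.
  by move=> cua; move: uv; rewrite ltnNge min //; apply/asboolP; exists u.
split; first by case: (C_split u cva).
by case: (C_split u (C_sym cab)) => [/ncua|/C_sym].
Qed.

(** Raising x towards [a] only weakens the demand that u /\ a lie below x. *)
Lemma record_monotone a b b' c v :
  tern b a b' -> record a b c v -> record a b' c v.
Proof.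
move=> bab' [cva h]; split=> // u /h [uva uab]; split=> //.
exact: C_sym (C_trans (C_sym uab) (C_sym bab')).
Qed.

(** Together with [record_base]: records depend only on the nodes a /\ b and a /\ c, which makes the
    colour independent of the labelling. *)
Lemma record_swapl a b c v : tern c a b -> record a b c v -> record b a c v.
Proof.
move=> cab [cva h]; split; first exact: C_path cab cva.
by move=> u /h [uva uab]; split; [exact: C_path uab uva|exact: C_sym].
Qed.

Lemma record_base a b c c' v : tern a c c' -> record a b c v -> record a b c' v.
Proof. by move=> acc' [cva h]; split=> //; exact: C_sym (C_base acc' (C_sym cva)). Qed.

(* The cone [set v | tern a v a'] of a' above a /\ a' contains no v with
   idx v < N, so every record inside it is beyond N. When record a a' c and
   record a b c agree, the two implications say that moving from a to a' changes
   no record before N. *)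
Lemma record_graft a b a' b' c N v :
  tern c a b -> tern b a a' -> tern a a' b' ->
  (forall u, (idx u < N)%N -> ~ tern a u a') -> (idx v < N)%N ->
  (record a' b' c v -> record a a' c v) /\
  (record a b c v -> record a' b' c v).
Proof.
move=> cab baa' aa'b' free vN.
have caa' : tern c a a' := C_sym (C_trans (C_sym cab) (C_sym baa')).
split=> [[cva' h]|/(record_monotone baa')[cva h]]; split.
- exact: C_path (C_sym caa') cva'.
- move=> u /h [uva' ua'b'].
  case: (C_split a uva') => [uaa'|/(free _ vN)//].
  by split=> //; exact: C_path (C_sym uaa') uva'.
- exact: C_path caa' cva.
- move=> u /h [uva uaa']; split; first exact: C_path uaa' uva.
  exact: C_sym (C_trans uaa' (C_sym aa'b')).
Qed.

(* All labellings of S give the same k, see C4_colourE. *)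
Definition C4_colour (S : set X) : nat :=
  xget 0%N [set k | exists a b c d, [/\ C4_labelled a b c d,
    S = [set a; b; c; d] & alternation idx (record a b c) (record c d a) k]].

Lemma C4_colourE a b c d k : C4_labelled a b c d ->
  alternation idx (record a b c) (record c d a) k ->
  C4_colour [set a; b; c; d] = k.
Proof.
move=> lab alt; apply: xget_unique; first by exists a, b, c, d.
move=> l [p [q [r [s [lab' E alt']]]]].
pose P p q r s := alternation idx (record p q r) (record r s p) k.
suff : P p q r s by move=> /alternation_uniq/(_ alt').
apply: (@C4_labelled_transport P a b c d) => //; last by rewrite E.
- move=> a1 b1 c1 d1 [ab cd cab acd]; apply: eq_alternation => v.
    by split; apply: record_swapl => //; exact: C_sym.
  by split; apply: record_base => //; exact: C_sym.
- by move=> a1 b1 c1 d1 _ /alternationC.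
Qed.

(** * Raising the number of alternations inside a subcopy *)

Variable D : set X.
Hypothesis dense : forall a b, D a -> D b -> a <> b ->
  exists2 a', D a' & a' <> a /\ tern b a a'.

(** If the leaf of index [N] lies in the current cone, it branches off from [a] at a /\ a'. A cone
    leaving [a] strictly higher misses it. *)
Lemma avoiding_cone N a b : D a -> D b -> a <> b ->
  exists2 a', D a' & [/\ a' <> a, tern b a a' &
    forall u, (idx u < N)%N -> ~ tern a u a'].
Proof.
elim: N b => [|N IH] b Da Db ab.
  by have [a' Da' [a'a baa']] := dense Da Db ab; exists a'.
have [a' Da' [a'a baa' free]] := IH b Da Db ab.
have [[w wN awa']|none] := pselect (exists2 w, idx w = N & tern a w a').
  have [a'' Da'' [a''a a'aa'' free']] := IH a' Da Da' (nesym a'a).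
  exists a'' => //; split=> //.
    exact: C_sym (C_trans (C_sym baa') (C_sym a'aa'')).
  move=> u; rewrite ltnS leq_eqVlt => /orP[/eqP uN|/free'//] aua''.
  have {uN}uw : u = w by apply: idx_inj; rewrite uN.
  case: (C_split a' aua'') => [/C_asym/(_ a'aa'')//|a'ua''].
  apply: (C_asym (C_sym awa')); rewrite -uw.
  exact: C_sym (C_path (C_sym a'aa'') a'ua'').
exists a' => //; split=> // u; rewrite ltnS leq_eqVlt => /orP[/eqP uN aua'|/free//].
by apply: none; exists u.
Qed.

(** The converse implication is [record_monotone], so moving b towards [a] within [D] no longer
    changes the records. *)
Definition stable a b c : Prop := forall b' v,
  D b' -> b' <> a -> tern b a b' -> record a b' c v -> record a b c v.

(** Records only accumulate as b' approaches [a], and [record_idx] bounds their indices, so finitely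
    many moves suffice. The induction settles one index at a time. *)
Lemma stabilise a b c : D a -> D b -> a <> b ->
  exists2 b', D b' & [/\ b' <> a, b' = b \/ tern b a b' & stable a b' c].
Proof.
move=> Da Db ab.
have [b' Db' [b'a bb' st]] : exists2 b', D b' &
    [/\ b' <> a, b' = b \/ tern b a b' & forall b'' v, (idx v < (idx a).+1)%N ->
     D b'' -> b'' <> a -> tern b' a b'' -> record a b'' c v -> record a b' c v].
  elim: (idx a).+1 => [|N [b' Db' [b'a bb' st]]].
    by exists b => //; split=> //; [exact: nesym|left].
  have bT b'' : tern b' a b'' -> tern b a b''.
    case: bb' => [->//|bab' b'ab''].
    exact: C_sym (C_trans (C_sym bab') (C_sym b'ab'')).
  have trans b1 b2 b3 : tern b1 a b2 -> tern b2 a b3 -> tern b1 a b3.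
    by move=> /C_sym h1 /C_sym h2; exact: C_sym (C_trans h1 h2).
  (* If some closer point of [D] makes the leaf of index [N] a record, moving there keeps it a
     record by monotonicity; otherwise b' stays. *)
  have [[w wN [b'' [Db'' b''a b'ab'' rw]]]|none] := pselect (exists2 w, idx w = N &
      exists b'', [/\ D b'', b'' <> a, tern b' a b'' & record a b'' c w]).
    exists b'' => //; split=> //; first by right; exact: bT.
    move=> b3 v; rewrite ltnS leq_eqVlt => /orP[/eqP vN|vN] Db3 b3a b''ab3 r3.
      by have -> : v = w by apply: idx_inj; rewrite vN.
    apply: (record_monotone b'ab''); apply: (st b3) => //.
    exact: trans b''ab3.
  exists b' => //; split=> // b'' v.
  rewrite ltnS leq_eqVlt => /orP[/eqP vN|vN] Db'' b''a b'ab'' r''; last exact: (st b'').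
  by case: none; exists v => //; exists b''.
exists b' => //; split=> // b'' v Db'' b''a b'ab'' r''.
by apply: (st b'') => //; rewrite ltnS; exact: record_idx r''.
Qed.

(* The last condition says on which branch the next block of records raises the
   number of alternations: the one towards a. *)
Definition C4_state k a b c d : Prop :=
  [/\ [/\ D a, D b, D c & D d], C4_labelled a b c d,
      stable a b c /\ stable c d a,
      alternation idx (record a b c) (record c d a) k &
      exists2 v, record c d a v & alternating idx (record a b c) (record c d a) k v].

Lemma C4_state_exists a b c d : D a -> D b -> D c -> D d ->
  C4_labelled a b c d -> exists k a' b' c' d', C4_state k a' b' c' d'.
Proof.
move=> Da Db Dc Dd [ab cd cab acd].
have [b' Db' [b'a bb' stab]] := stabilise c Da Db ab.
have [d' Dd' [d'c dd' stcd]] := stabilise a Dc Dd cd.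
have cab' : tern c a b'.
  by case: bb' => [->//|bab']; exact: C_sym (C_trans (C_sym cab) (C_sym bab')).
have acd' : tern a c d'.
  by case: dd' => [->//|dcd']; exact: C_sym (C_trans (C_sym acd) (C_sym dcd')).
have [w rw] := record_exists cab'.
have [||k alt] := @alternation_exists _ idx (record a b' c) (record c d' a)
    (idx a + idx c).
- by exists w.
- move=> v [/record_idx|/record_idx] h; apply: leq_trans h _.
    exact: leq_addr.
  exact: leq_addl.
have [[v altv] _] := alt; exists k.
(* The branch on which a longest sequence ends is listed second. *)
have [rv|rv] := alternating_mem altv.
  exists c, d', a, b'; split=> //.
  - by split=> //; exact: nesym.
  - exact: alternationC.
  - by exists v => //; exact: alternatingC.
exists a, b', c, d'; split=> //; last by exists v.
by split=> //; exact: nesym.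
Qed.

Lemma C4_state_succ k a b c d : C4_state k a b c d ->
  exists a' b', C4_state k.+1 c d a' b'.
Proof.
move=> [[Da Db Dc Dd] [ab cd cab acd] [stab stcd] alt altc].
(* All records on both branches have index below this bound; the new pair a', b' is taken in a cone
   without such leaves. *)
have [a' Da' [a'a baa' free]] := avoiding_cone (idx a + idx c).+1 Da Db ab.
have [b0 Db0 [b0a' aa'b0]] := dense Da' Da a'a.
have [b' Db' [b'a' b0b' stab']] := stabilise c Da' Db0 (nesym b0a').
have aa'b' : tern a a' b'.
  by case: b0b' => [->//|h]; exact: C_sym (C_trans (C_sym aa'b0) (C_sym h)).
have caa' : tern c a a' := C_sym (C_trans (C_sym cab) (C_sym baa')).
have ca'b' : tern c a' b' := C_sym (C_trans caa' (C_sym aa'b')).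
have a'cd : tern a' c d := C_base caa' acd.
have recE v : record c d a v <-> record c d a' v.
  by split; apply: record_base => //; exact: C_sym.
(* A record over the base a /\ a' lies in the free cone, so its index is large; it is also a record
   over the lower base a /\ c. *)
have [v0 rv0] := record_exists aa'b'.
have [alt' last'] : alternation idx (record a' b' c) (record c d a) k.+1 /\
    exists2 v, record a' b' c v & alternating idx (record a' b' c) (record c d a) k.+1 v.
  apply: alternation_extend alt altc => [v vN|v /record_idx|].
  (* Before the bound the new records lie between those for (a, b) and those for (a, a'), which
     agree by stability. *)
  - have [r1 r2] := record_graft cab baa' aa'b' free vN.
    by split=> // /r1; exact: stab.
  - by move=> vc; rewrite ltnS (leq_trans vc) // leq_addl.
  - exists v0; first by case: rv0 => av0a' h; split=> //; exact: C_trans caa' av0a'.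
    by rewrite leqNgt; apply/negP => /free; apply; case: rv0.
have E : record c d a = record c d a' by apply/funext => v; exact/propext/recE.
rewrite E in alt' last'.
(* The branches trade places, since a longest sequence now ends on the new branch. *)
exists a', b'; split=> //.
- by split=> //; exact: nesym.
- split=> // d' v Dd' d'c dcd' r; apply/recE/(stcd d') => //.
  by apply: record_base r; exact: C_sym.
- exact: alternationC.
- by case: last' => v rv altv; exists v => //; exact: alternatingC.
Qed.

Lemma C4_state_cofinal a b c d : D a -> D b -> D c -> D d ->
  C4_labelled a b c d -> exists k0, forall k, (k0 <= k)%N ->
    exists a' b' c' d', C4_state k a' b' c' d'.
Proof.
move=> Da Db Dc Dd lab; have [k0 st0] := C4_state_exists Da Db Dc Dd lab.
exists k0 => k /subnK <-; elim: (k - k0)%N => // n [a1 [b1 [c1 [d1 st]]]].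
by have [a' [b' st']] := C4_state_succ st; exists c1, d1, a', b'.
Qed.

End Enumeration.
End CRelation.

(** * C_4 and two-point substructures *)

Lemma C_relation_preimage (X Y : ternary) (e : X -> Y) : injective e ->
  (forall x y z, tern x y z <-> tern (e x) (e y) (e z)) ->
  C_relation Y -> C_relation X.
Proof.
move=> inj eE [fin [d [T [meet [pt [f [finj mx Rf]]]]]]]; split.
  have -> : [set: X] = e @^-1` setT by [].
  by apply: finite_preimage => // x y _ _; exact: inj.
exists d, T, meet; split=> //; exists (f \o e); split=> [|x t|x y z].
- exact: inj_comp.
- exact: mx.
- by rewrite eE Rf.
Qed.

Lemma binary_C_relationW (X : ternary) : binary_C_relation X -> C_relation X.
Proof.
by move=> [fin [d [T [meet [[pt _] ls]]]]]; split=> //; exists d, T, meet.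
Qed.

Lemma C4_tree_binary : binary_pseudotree C4_tree_meet.
Proof.
split; first exact: C4_tree_pseudotree.
move=> a x y z; rewrite !lt_neqAle !C4_tree_leE => ax ay az [E E1 E2].
move: ax ay az E1 E2; rewrite {}E {a}.
by move: x y z => [[[] [[]|]]|] [[[] [[]|]]|] [[[] [[]|]]|].
Qed.

(** The pseudotree supplied by [is_C4] need not be binary, but by uniqueness [R] is also read off
    from the explicit binary tree. *)
Lemma C4_binary R : is_C4 R -> binary_C_relation (Ternary R).
Proof.
move=> CR; have [R1 [_ uniqR]] := C4_exists_unique.
pose m x y := C4_tree_meet (C4_leaf x) (C4_leaf y).
pose R0 x y z := is_true (m x y < m y z)%O.
have inj : injective C4_leaf by case=> -[].
have fin : finite_set [set: Ternary R0].
  have -> : [set: Ternary R0] = C4_leaf @^-1` setT by [].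
  by apply: finite_preimage => [x y _ _ /inj//|]; exact: finite_finset.
have ls : leaf_structure C4_tree_meet (Ternary R0).
  by exists C4_leaf; split=> // x t; rewrite C4_tree_leE; move: x t => [] [[[] [[]|]]|].
have C0 : is_C4 R0.
  split=> //; split=> //; exists C4_tree_display, C4_tree, C4_tree_meet.
  by split=> //; exact: C4_tree_pseudotree.
have -> : R = R0 by rewrite -(uniqR _ CR) -(uniqR _ C0).
split=> //; exists C4_tree_display, C4_tree, C4_tree_meet; split=> //.
exact: C4_tree_binary.
Qed.

Lemma tern_pair (X : ternary) (p q u v w : X) : C_axioms X ->
  [set p; q] u -> [set p; q] v -> [set p; q] w ->
  tern u v w <-> u <> v /\ v = w.
Proof.
move=> ax pu pv pw; split=> [uvw|[uv <-]]; last exact: C_neq.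
have uv : u <> v by move=> E; move: uvw; rewrite E; exact: C_irrefl.
have uw : u <> w by move=> E; move: uvw; rewrite E; exact: C_irreflr.
by split=> //; case: pu pv pw uv uw => -> [] -> [] ->.
Qed.

(** By [tern_pair] the relation on two points carries no information; homogeneity can then move any
    pair to any other. *)
Lemma pair_isomorphism (X : ternary) (p q a b : X) : C_axioms X ->
  p <> q -> a <> b ->
  exists2 f : induced [set p; q] -> induced [set a; b], isomorphism f &
    forall x, (val x = p -> val (f x) = a) /\ (val x = q -> val (f x) = b).
Proof.
move=> ax pq ab.
have build (u v u' v' : X) : u <> v ->
    exists f : induced [set u; v] -> induced [set u'; v'],
      forall x, (val x = u -> val (f x) = u') /\ (val x = v -> val (f x) = v').
  move=> uv; have mu : u' \in [set u'; v'] by rewrite inE; left.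
  have mv : v' \in [set u'; v'] by rewrite inE; right.
  exists (fun x => if pselect (val x = u) then SigSub mu else SigSub mv) => x.
  by case: pselect => [E|ne] /=; split=> // E'; case: uv; exact: etrans (esym E) E'.
have mem (u v : X) (x : induced [set u; v]) : val x = u \/ val x = v.
  by have := valP x; rewrite inE.
have [f fE] := build p q a b pq; have [g gE] := build a b p q ab.
have fK : cancel f g.
  move=> x; apply: val_inj; have [fa fb] := fE x; have [ga gb] := gE (f x).
  by case: (mem _ _ x) => h; rewrite h; [exact/ga/fa|exact/gb/fb].
have gK : cancel g f.
  move=> x; apply: val_inj; have [ga gb] := gE x; have [fa fb] := fE (g x).
  by case: (mem _ _ x) => h; rewrite h; [exact/fa/ga|exact/fb/gb].
exists f => //; split; first by exists g.
move=> x y z; apply: iff_trans (tern_pair ax (mem _ _ x) (mem _ _ y) (mem _ _ z)) _.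
apply: iff_trans; last first.
  exact: iff_sym (tern_pair ax (mem _ _ (f x)) (mem _ _ (f y)) (mem _ _ (f z))).
have inj := can_inj fK; split=> -[ne /val_inj E].
  by rewrite -E; split=> // /val_inj/inj E'; apply: ne; rewrite E'.
by rewrite -(inj _ _ E); split=> // /val_inj E'; apply: ne; rewrite E'.
Qed.

(** * Fraïssé limits *)

Section FraisseLimit.
Variables (K : ternary -> Prop) (M : ternary).
Variable R4 : C4_point -> C4_point -> C4_point -> Prop.
Hypotheses (KC : forall X, K X -> C_relation X) (K4 : K (Ternary R4)).
Hypotheses (HR4 : is_C4 R4) (HM : Fraisse_limit K M).

Lemma limit_C_axioms : C_axioms M.
Proof. by case: HM => _ + _ _ => age; apply: C_axioms_of_finite => S /age/KC. Qed.

Lemma limit_has_C4 : exists2 e : C4_point -> M, injective e &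
  forall x y z, tern (e x) (e y) (e z) <-> R4 x y z.
Proof.
have [_ _ /(_ _ K4)[S [h [[g hK gK] hR]]] _] := HM.
exists (fun x => val (g x)) => [x y /val_inj/(can_inj gK)//|x y z].
by have := hR (g x) (g y) (g z); rewrite !gK.
Qed.

(** Homogeneity carries the points a and c of some copy of C_4 to [a] and [b]; the image of its
    point b is then a'. *)
Lemma limit_dense (a b : M) : a <> b -> exists2 a', a' <> a & tern b a a'.
Proof.
move=> ab; have [e inj eR] := limit_has_C4; have [_ _ _ Rcab] := HR4.
have pq : e C4a <> e C4c by move=> /inj.
have [f iso fE] := pair_isomorphism limit_C_axioms pq ab.
have [_ _ _ hom] := HM.
have fin : finite_set [set e C4a; e C4c].
  by rewrite finite_setU; split; exact: finite_set1.
have [g [[g' gK g'K] gR] gE] := hom _ _ f fin iso.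
have ma : e C4a \in [set e C4a; e C4c] by rewrite inE; left.
have mc : e C4c \in [set e C4a; e C4c] by rewrite inE; right.
have ga : g (e C4a) = a by rewrite (gE (SigSub ma)); exact: (fE (SigSub ma)).1.
have gc : g (e C4c) = b by rewrite (gE (SigSub mc)); exact: (fE (SigSub mc)).2.
exists (g (e C4b)).
  by rewrite -ga => /(can_inj gK)/inj.
by rewrite -ga -gc; apply: (gR _ _ _).1; exact/eR.
Qed.

Lemma subcopy_dense (D : set M) : copies M M D ->
  forall a b, D a -> D b -> a <> b -> exists2 a', D a' & a' <> a /\ tern b a a'.
Proof.
move=> [h [[g hK gK] hR]] a b /mem_set Da /mem_set Db ab.
have ne : h (SigSub Da) <> h (SigSub Db).
  by move=> /(can_inj hK)/(congr1 val).
have [a' a'a baa'] := limit_dense ne.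
exists (val (g a')); first exact/set_mem/valP.
split.
  by move=> E; apply: a'a; rewrite -[a']gK; congr h; exact: val_inj.
by apply: (hR (SigSub Db) (SigSub Da) (g a')).2; rewrite gK.
Qed.

Lemma subcopy_has_C4 (D : set M) : copies M M D ->
  exists a b c d, [/\ D a, D b, D c & D d] /\ C4_labelled a b c d.
Proof.
move=> [h [[g hK gK] hR]]; have [e inj eR] := limit_has_C4.
pose e' x := val (g (e x)).
have inj' : injective e' by move=> x y /val_inj/(can_inj gK)/inj.
have eR' x y z : R4 x y z -> tern (e' x) (e' y) (e' z).
  move=> /eR H; apply: (hR (g (e x)) (g (e y)) (g (e z))).2.
  by rewrite !gK.
have De x : D (e' x) by exact/set_mem/valP.
have [_ Racd Rbcd Rcab] := HR4.
exists (e' C4a), (e' C4b), (e' C4c), (e' C4d); split=> //.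
by split; [move=> /inj'|move=> /inj'|exact: eR'|exact: eR'].
Qed.

Lemma labelled_copy (a b c d : M) : C4_labelled a b c d ->
  copies M (Ternary R4) [set a; b; c; d].
Proof.
move=> lab; have ax := limit_C_axioms.
have [ab cd cab acd] := lab.
have [_ _ _ bcd] := C4_labelled_swapl ax lab.
pose S := [set a; b; c; d].
have ma : a \in S by rewrite inE; left; left; left.
have mb : b \in S by rewrite inE; left; left; right.
have mc : c \in S by rewrite inE; left; right.
have md : d \in S by rewrite inE; right.
pose e (x : C4_point) : induced S := match x with
  | C4a => SigSub ma | C4b => SigSub mb | C4c => SigSub mc | C4d => SigSub md end.
have ne (x y z : M) : tern x y z -> x <> y /\ x <> z.
  move=> xyz; split=> E; move: xyz; rewrite E; first exact: C_irrefl.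
  exact: C_irreflr.
have [[ca cb] [ac ad] [bc bd]] := And3 (ne _ _ _ cab) (ne _ _ _ acd) (ne _ _ _ bcd).
have inj : injective e.
  by move=> [] [] // /(congr1 val) /= E; exfalso; auto.
have surj (x : induced S) : exists y, e y = x.
  have := set_mem (valP x); case=> [[[]|]|] E; [exists C4a|exists C4b|exists C4c|exists C4d];
    exact: val_inj.
have [g gK] := choice surj.
(* The relation pulled back along the labelling satisfies [is_C4], so uniqueness identifies it with
   [R4]. *)
have -> : R4 = fun x y z => tern (e x) (e y) (e z).
  have [R1 [_ uniqR]] := C4_exists_unique.
  rewrite -(uniqR _ HR4); apply: uniqR; split=> //.
  apply: (@C_relation_preimage (Ternary (fun x y z => tern (e x) (e y) (e z)))
    (induced S) e) => //.
  have [_ age _ _] := HM; apply/KC/age.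
  by rewrite /S !finite_setU; do !split; exact: finite_set1.
exists g; split=> [|x y z] /=; last by rewrite !gK.
by exists e => // x; apply: inj; rewrite gK.
Qed.

Lemma limit_no_arrow l : ~ arrow M (Ternary R4) l.+1.
Proof.
have [/countable_injP[idx /in2TT idx_inj] _ _ _] := HM.
have ax := limit_C_axioms.
(* The residue is at most [l], so [inord] never takes its default value. *)
move=> /(_ (fun S => inord (C4_colour idx (val S) %% l.+1))) [D cD].
apply; apply/seteqP; split=> // j _.
have [a [b [c [d [[Da Db Dc Dd] lab]]]]] := subcopy_has_C4 cD.
have [k0 cof] := C4_state_cofinal ax idx_inj (subcopy_dense cD) Da Db Dc Dd lab.
(* This number is at least [k0] and congruent to [j] modulo [l.+1]. *)
have [|a' [b' [c' [d' [[Da' Db' Dc' Dd'] lab' _ alt _]]]]] := cof (k0 * l.+1 + j)%N.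
  by rewrite mulnS -addnA leq_addr.
exists (SigSub (mem_set (labelled_copy lab'))).
  by move=> x [[[]|]|] ->.
rewrite /= (C4_colourE ax lab' alt).
by apply: val_inj; rewrite /= modnMDl modn_small ?inordK.
Qed.

Lemma limit_big_ramsey_degree : big_ramsey_degree M (Ternary R4) = None.
Proof.
rewrite /big_ramsey_degree; case: pselect => // h; exfalso.
by case: h => l /asboolP /limit_no_arrow.
Qed.

End FraisseLimit.

Theorem theorem11 (C2 Comega : ternary)
    (R4 : C4_point -> C4_point -> C4_point -> Prop)
    (HC2 : Fraisse_limit binary_C_relation C2)
    (HComega : Fraisse_limit C_relation Comega)
    (HC4 : is_C4 R4) :
  big_ramsey_degree C2 (Ternary R4) = None /\
  big_ramsey_degree Comega (Ternary R4) = None.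
Proof.
split; last by apply: limit_big_ramsey_degree HComega => //; case: HC4.
exact: limit_big_ramsey_degree binary_C_relationW (C4_binary HC4) HC4 HC2.
Qed.
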